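(* Let $A, B, C \in \mathbb{C}$ with $A \neq 0$, and write $A = re^{i\theta}$ with $r > 0$ and $\theta \in \mathbb{R}$. Then the solution set of the inequality $AZ^2 + BZ + C \geq 0$ is $$\{Z \in \mathbb{C} : AZ^2 + BZ + C \geq 0\} = e^{-i\theta/2}\cdot\mathscr{D}^{1/2}\left(\frac{B^2 - 4AC}{4rA}\right) - \frac{B}{2A}.$$
   Context: The relation $\geq$ on $\mathbb{C}$ is defined as follows: for $A = a_1 + a_2 i$, $B = b_1 + b_2 i$ with $a_1,a_2,b_1,b_2 \in \mathbb{R}$, $A \geq B$ means: $a_1 > b_1$, or ($a_1 = b_1$ and $a_2 \geq b_2$). For $A \in \mathbb{C}$, $\mathscr{D}(A) := \{Z \in \mathbb{C} : Z \geq A\}$. For $\mathscr{B} \subset \mathbb{C}$, $\theta \in \mathbb{R}$ and $A \in \mathbb{C}$: the rotation set is $e^{i\theta}\mathscr{B} := \{Ze^{i\theta} : Z \in \mathscr{B}\}$ (also written $\mathscr{B}\cdot e^{i\theta}$); the translation set is $\mathscr{B} + A := \{Z + A : Z \in \mathscr{B}\}$, and $\mathscr{B} - A := \mathscr{B} + (-A)$; the radication set $\mathscr{B}^{1/2} := \{Z^{1/2} : Z \in \mathscr{B}\}$ is the set of all complex square roots (both values $\pm W$ with $W^2 = Z$) of elements $Z$ of $\mathscr{B}$. $\mathscr{D}^{1/2}(A)$ denotes $(\mathscr{D}(A))^{1/2}$. *)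

(* Defs.v *)
From mathcomp Require Import all_boot all_order all_algebra.
From mathcomp Require Import classical_sets reals trigo.
From mathcomp Require Import complex.

Set Implicit Arguments.
Unset Strict Implicit.
Unset Printing Implicit Defensive.

Import Order.TTheory GRing.Theory Num.Theory.

Local Open Scope ring_scope.
Local Open Scope classical_set_scope.
Local Open Scope complex_scope.

(* Lexicographic total order. The order that R[i] carries canonically
   is a different one: it only compares numbers with equal imaginary parts. *)
Definition lex_ge (R : realType) (A B : R[i]) : bool :=
  (complex.Re A > complex.Re B) ||
  (complex.Re A == complex.Re B) && (complex.Im A >= complex.Im B).

Definition upper_set (R : realType) (A : R[i]) : set R[i] :=
  [set Z | lex_ge Z A].

(* The complex number e^{i theta}. *)
Definition expi (R : realType) (theta : R) : R[i] :=
  cos theta +i* sin theta.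

Definition rotation_set (R : realType) (theta : R) (S : set R[i]) :
    set R[i] :=
  [set Z * expi theta | Z in S].

Definition translation_set (R : realType) (S : set R[i]) (A : R[i]) :
    set R[i] :=
  [set Z + A | Z in S].

(* Both square roots of every element, not only the principal one. *)
Definition radication_set (R : realType) (S : set R[i]) : set R[i] :=
  [set W | exists2 Z, S Z & W ^+ 2 = Z].

(* Main.v *)
Require Import Defs.
From mathcomp Require Import all_boot all_order all_algebra.
From mathcomp Require Import classical_sets reals trigo.
From mathcomp Require Import complex.
From mathcomp Require Import ring.

Import Order.TTheory GRing.Theory Num.Theory.

Local Open Scope ring_scope.
Local Open Scope classical_set_scope.
Local Open Scope complex_scope.

(** The lexicographic order is compatible with translations and with
    multiplication by positive reals, but not by complex numbers, so one may
    divide the inequality by r but not by A. Completing the square gives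
    A Z^2 + B Z + C = A (Z + B / 2A)^2 - (B^2 - 4AC) / 4A, and the phase of A
    can be absorbed into the square: with W = (Z + B / 2A) e^{i theta / 2} the
    right-hand side is r (W^2 - (B^2 - 4AC) / 4rA) ([quadratic_rotated]). The
    inequality thus says that W^2 dominates (B^2 - 4AC) / 4rA
    ([lex_ge_scale_sub]), and Z is recovered from W as
    W e^{- i theta / 2} - B / 2A. *)

Lemma expiD (R : realType) (s t : R) : expi (s + t) = expi s * expi t.
Proof.
rewrite /expi cosD sinD; apply/eqP; rewrite eq_complex /= eqxx /=.
by rewrite addrC [cos s * _ + _]addrC eqxx.
Qed.

Lemma expiNK (R : realType) (t : R) : expi (- t) * expi t = 1.
Proof. by rewrite -expiD addNr /expi cos0 sin0. Qed.

Lemma lex_ge_scale_sub (R : realType) (r : R) (X D : R[i]) :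
  0 < r -> lex_ge (r%:C * (X - D)) 0 = lex_ge X D.
Proof.
case: X D => [x1 x2] [d1 d2] r_gt0; rewrite /lex_ge /= !mul0r subr0 addr0.
by rewrite !pmulr_rgt0 // pmulr_rge0 // mulf_eq0 gt_eqF //= subr_gt0 subr_ge0
  subr_eq0.
Qed.

(** Moving the phase of A into the square, as e^{i theta} is the square of
    e^{i theta / 2}, leaves only the positive factor r outside, which the
    order tolerates. *)
Lemma quadratic_rotated (R : realType) (A B C Z : R[i]) (r theta : R) :
  A != 0 -> 0 < r -> A = r%:C * expi theta ->
  A * Z ^+ 2 + B * Z + C =
  r%:C * (((Z + B / (2 * A)) * expi (theta / 2)) ^+ 2
          - (B ^+ 2 - 4 * A * C) / (4 * r%:C * A)).
Proof.
move=> A_neq0 r_gt0 A_polar.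
have rC_neq0 : r%:C != 0 :> R[i].
  by rewrite eq_complex /= eqxx andbT gt_eqF.
have rotA : r%:C * expi (theta / 2) ^+ 2 = A.
  by rewrite expr2 -expiD -splitr.
rewrite exprMn mulrBr (mulrCA r%:C) rotA.
by field; rewrite A_neq0 rC_neq0.
Qed.

Theorem mainTheorem12 (R : realType) (A B C : R[i]) (r theta : R)
  (A_neq0 : A != 0) (r_gt0 : 0 < r) (A_polar : A = r%:C * expi theta) :
  [set Z : R[i] | lex_ge (A * Z ^+ 2 + B * Z + C) 0] =
  translation_set
    (rotation_set (- theta / 2)
      (radication_set
        (upper_set ((B ^+ 2 - 4 * A * C) / (4 * r%:C * A)))))
    (- (B / (2 * A))).
Proof.
have solE Z : lex_ge (A * Z ^+ 2 + B * Z + C) 0 =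
    lex_ge (((Z + B / (2 * A)) * expi (theta / 2)) ^+ 2)
           ((B ^+ 2 - 4 * A * C) / (4 * r%:C * A)).
  rewrite (quadratic_rotated _ _ B C Z _ _ A_neq0 r_gt0 A_polar).
  exact: lex_ge_scale_sub.
have rotK : expi (theta / 2) * expi (- theta / 2) = 1.
  by rewrite mulrC mulNr expiNK.
apply/seteqP; split => Z /=.
  rewrite solE => ge_Z.
  exists (Z + B / (2 * A)); last by rewrite addrK.
  exists ((Z + B / (2 * A)) * expi (theta / 2)).
    by exists (((Z + B / (2 * A)) * expi (theta / 2)) ^+ 2).
  by rewrite -mulrA rotK mulr1.
case=> _ [W [V ge_W W2E] <-] <-.
by rewrite solE subrK -mulrA [expi (- _ / _) * _]mulrC rotK mulr1 W2E.
Qed.
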